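(* Let $\mathcal H$ be a family of loop graphs, and write $\mathcal H\text{-cw}(G)$ for the $\mathcal H$-clique-width of $G$ and $\mathrm{cw}(G)$ for its clique-width. There exists a function $f:\mathbb N\to\mathbb N$ such that $\mathrm{cw}(G)\le f(\mathcal H\text{-cw}(G))$ holds for all simple graphs $G$ (the inequality being considered void when $\mathcal H\text{-cw}(G)=\infty$), if and only if $\mathcal H$ is of component-bounded total neighbourhood diversity.
   Context: All graphs are finite. Simple graphs have no loops and no parallel edges. A loop graph has no parallel edges, but may have at most one loop per vertex. Two vertices $x,y$ of a loop graph $G$ are of the same total neighbourhood type iff they have the same set of neighbours in $V(G)$, where a vertex counts as a neighbour of itself iff it has a loop. A loop graph $G$ is of total neighbourhood diversity at most $d$ if $V(G)$ can be partitioned into $d$ parts such that every two vertices in the same part have the same total neighbourhood type. A class of loop graphs is of component-bounded total neighbourhood diversity if there is an integer $d$ such that each connected component of every graph of the class is of total neighbourhood diversity at most $d$. Clique-width $\mathrm{cw}(G)$: the least $\ell$ such that $G$ (irrespective of labels) is the value of an $\ell$-expression built with the operations: create a new vertex of label $i\in\{1,\dots,\ell\}$; disjoint union of two labelled graphs; for $i\ne j$, add all missing edges between vertices of label $i$ and vertices of label $j$; for $i\neq j$, relabel all vertices of label $i$ to label $j$. $\mathcal H$-clique-width: for $H\in\mathcal H$ and an integer $\ell>0$, an $(H,\ell)$-expression is an algebraic expression on graphs whose vertices carry labels $(i,v)$ with $i\in\{1,\dots,\ell\}$ and $v\in V(H)$, using the operations: create a new vertex with a single label $(i,v)$; disjoint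 union of two labelled graphs; for $1\le i\ne j\le\ell$, add all edges between the vertices of label $(i,v)$ and the vertices of label $(j,w)$ over all pairs $(v,w)\in V(H)\times V(H)$ with $vw\in E(H)$ (including $v=w$ when $v$ has a loop in $H$); for $1\le i\neq j\le\ell$, relabel every vertex with label $(i,v)$, $v\in V(H)$, to $(j,v)$. The $\mathcal H$-clique-width $\mathcal H\text{-cw}(G)$ of a simple graph $G$ is the smallest $\ell$ such that (some labelling of) $G$ is the value of an $(H,\ell)$-expression for some $H\in\mathcal H$, and $\infty$ if there is no such $\ell$. *)

(* Defs.v *)
From mathcomp Require Import all_boot.
From mathcomp Require Import boolp.

Set Implicit Arguments.
Unset Strict Implicit.
Unset Printing Implicit Defensive.

(** * Graphs *)

(* A vertex x carries a loop iff [ladj x x]. *)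
Record loopGraph := LoopGraph {
  lvertex :> finType;
  ladj : rel lvertex;
  ladj_sym : symmetric ladj }.

Record simpleGraph := SimpleGraph {
  svertex :> finType;
  sadj : rel svertex;
  sadj_sym : symmetric sadj;
  sadj_irr : irreflexive sadj }.

Section Induced.
Variables (G : loopGraph) (A : {set G}).

Definition induced_adj : rel {x : G | x \in A} :=
  fun x y => ladj (val x) (val y).

Lemma induced_adj_sym : symmetric induced_adj.
Proof. by move=> x y; rewrite /induced_adj ladj_sym. Qed.

Definition induced : loopGraph := LoopGraph induced_adj_sym.
End Induced.

Definition component (G : loopGraph) (x : G) : loopGraph :=
  induced [set y | connect (@ladj G) x y].

(** * Total neighbourhood diversity *)

Definition neighbours (G : loopGraph) (x : G) : {set G} := [set z | ladj x z].

Definition same_total_type (G : loopGraph) (x y : G) : Prop :=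
  neighbours x = neighbours y.

(* The blocks of a [partition] are nonempty, so "d parts" is read as
   "at most d nonempty parts". *)
Definition total_nd_at_most (G : loopGraph) (d : nat) : Prop :=
  exists P : {set {set G}},
    [/\ partition P [set: G], #|P| <= d &
        forall (B : {set G}) (x y : G),
          B \in P -> x \in B -> y \in B -> same_total_type x y].

Definition component_bounded_total_nd (HH : loopGraph -> Prop) : Prop :=
  exists d : nat, forall H : loopGraph, HH H ->
    forall x : H, total_nd_at_most (component x) d.

(** * Labelled graphs and the operations on them *)

Record labelledGraph (L : Type) := LabelledGraph {
  gvertex : finType;
  gadj : rel gvertex;
  glab : gvertex -> L }.

Section Operations.
Variable L : Type.
Implicit Types g : labelledGraph L.

Definition lg_vertex (a : L) : labelledGraph L :=
  @LabelledGraph L unit (fun _ _ => false) (fun _ => a).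

Definition lg_union g1 g2 : labelledGraph L :=
  @LabelledGraph L (gvertex g1 + gvertex g2)%type
    (fun x y => match x, y with
                | inl x1, inl y1 => gadj x1 y1
                | inr x2, inr y2 => gadj x2 y2
                | _, _ => false
                end)
    (fun x => match x with inl x1 => glab x1 | inr x2 => glab x2 end).

Definition lg_join (r : rel L) g : labelledGraph L :=
  @LabelledGraph L (gvertex g)
    (fun x y => [|| gadj x y, r (glab x) (glab y) | r (glab y) (glab x)])
    (@glab L g).

Definition lg_relabel (h : L -> L) g : labelledGraph L :=
  @LabelledGraph L (gvertex g) (@gadj L g) (fun x => h (glab x)).
End Operations.

Definition is_value_of (G : simpleGraph) (L : Type) (g : labelledGraph L) : Prop :=
  exists phi : G -> gvertex g,
    bijective phi /\ forall x y : G, gadj (phi x) (phi y) = sadj x y.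

(** * Clique-width *)

(* N extended by infinity, which is represented by None. *)
Definition exnat := option nat.

Definition exnat_le (a b : exnat) : bool :=
  match a, b with
  | _, None => true
  | None, Some _ => false
  | Some m, Some n => m <= n
  end.

Definition least (P : nat -> Prop) : exnat :=
  match pselect (exists n, `[< P n >]) with
  | left ex => Some (ex_minn ex)
  | right _ => None
  end.

Inductive cw_expr (l : nat) : Type :=
| CVertex (i : 'I_l)
| CUnion (e1 e2 : cw_expr l)
| CJoin (i j : 'I_l) (neq_ij : i != j) (e : cw_expr l)
| CRelabel (i j : 'I_l) (neq_ij : i != j) (e : cw_expr l).

Fixpoint cw_eval (l : nat) (e : cw_expr l) : labelledGraph 'I_l :=
  match e with
  | CVertex i => lg_vertex i
  | CUnion e1 e2 => lg_union (cw_eval e1) (cw_eval e2)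
  | CJoin i j _ e => lg_join (fun a b => (a == i) && (b == j)) (cw_eval e)
  | CRelabel i j _ e =>
      lg_relabel (fun a => if a == i then j else a) (cw_eval e)
  end.

(* No expression produces the graph without vertices, whose clique-width and
   HH-clique-width are therefore both None. *)
Definition cw (G : simpleGraph) : exnat :=
  least (fun l => exists e : cw_expr l, is_value_of G (cw_eval e)).

Inductive hcw_expr (H : loopGraph) (l : nat) : Type :=
| HVertex (i : 'I_l) (v : H)
| HUnion (e1 e2 : hcw_expr H l)
| HJoin (i j : 'I_l) (neq_ij : i != j) (e : hcw_expr H l)
| HRelabel (i j : 'I_l) (neq_ij : i != j) (e : hcw_expr H l).

Fixpoint hcw_eval (H : loopGraph) (l : nat) (e : hcw_expr H l) :
    labelledGraph ('I_l * H) :=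
  match e with
  | HVertex i v => lg_vertex (i, v)
  | HUnion e1 e2 => lg_union (hcw_eval e1) (hcw_eval e2)
  | HJoin i j _ e =>
      lg_join (fun a b => [&& a.1 == i, b.1 == j & ladj a.2 b.2]) (hcw_eval e)
  | HRelabel i j _ e =>
      lg_relabel (fun a => if a.1 == i then (j, a.2) else a) (hcw_eval e)
  end.

Definition hcw (HH : loopGraph -> Prop) (G : simpleGraph) : exnat :=
  least (fun l => 0 < l /\ exists2 H : loopGraph, HH H &
           exists e : hcw_expr H l, is_value_of G (hcw_eval e)).

(* Main.v *)
(* If every component of H has at most d total neighbourhood types, an
   expression over H can be restricted to the vertices labelled by one component
   c; there a label (i, v) may be replaced by (i, type of v), since adjacency
   within c depends on types only. Vertices labelled by different components are
   never adjacent, so the disjoint union of the restricted expressions uses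
   l * d labels.

   Conversely, take the strong product of a component C with a star with m
   leaves, a copy of C ("row") for each vertex of the star; its H-clique-width
   is at most 4. If its clique-width is at most k, a subexpression gives a vertex
   set S meeting more than k + 1 but at most 2k + 2 rows, whose vertices have at
   most k neighbourhoods outside S. For m = 2k + 2 some row misses S. Some row
   also lies inside S, as otherwise connectedness of C gives more than k leaf
   rows with an edge leaving S. Hence, for every w in C, there are copies of w in
   S and outside S in adjacent rows, so that the labels in S and the sets of
   labels seen from outside S determine the adjacency between w and any v. The
   number of types of C is thus bounded in terms of k. *)
Require Import Defs.
From mathcomp Require Import all_boot.
From mathcomp Require Import boolp.

Set Implicit Arguments.
Unset Strict Implicit.
Unset Printing Implicit Defensive.

Lemma least_le (P : nat -> Prop) n :
  P n -> exists2 m, least P = Some m & m <= n.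
Proof.
move=> Pn; rewrite /least; case: pselect => [ex|nex].
  exists (ex_minn ex) => //.
  by case: ex_minnP => m _; apply; apply/asboolP.
by case: nex; exists n; apply/asboolP.
Qed.

Lemma least_Some (P : nat -> Prop) n : least P = Some n -> P n.
Proof.
rewrite /least; case: pselect => // ex [<-].
by case: ex_minnP => m /asboolP.
Qed.

Lemma cw_le (G : simpleGraph) l (e : cw_expr l) :
  is_value_of G (cw_eval e) -> exnat_le (cw G) (Some l).
Proof.
move=> vG; have [|k ck kl] := @least_le
  (fun l => exists e : cw_expr l, is_value_of G (cw_eval e)) l.
  by exists e.
by rewrite /cw ck.
Qed.

Lemma loop_connect_sym (H : loopGraph) : connect_sym (@ladj H).
Proof. exact/sym_connect_sym/ladj_sym. Qed.

(** * Vertex sets of a fixed graph as values of expressions *)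

(* Empty sets count as represented because no expression has an empty value. *)
Definition represents (L : Type) (V : labelledGraph L -> Prop) (U : finType)
    (E : rel U) (lab : U -> L) (A : {set U}) : Prop :=
  A = set0 \/ exists2 g, V g & exists phi : gvertex g -> U,
    [/\ injective phi, phi @: setT = A,
        forall x y, gadj x y = E (phi x) (phi y) &
        forall x, glab x = lab (phi x)].

Section Represents.
Variables (L : Type) (V : labelledGraph L -> Prop).
Implicit Types U : finType.

Lemma represents_ext U (E E' : rel U) (lab lab' : U -> L) (A : {set U}) :
  {in A &, E =2 E'} -> {in A, lab =1 lab'} ->
  represents V E lab A -> represents V E' lab' A.
Proof.
move=> eE el [->|[g Vg [phi [inj im adj lb]]]]; first by left.
have inA x : phi x \in A by rewrite -im imset_f.
right; exists g => //; exists phi; split=> // [x y|x].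
  by rewrite adj eE.
by rewrite lb el.
Qed.

Lemma represents_imset U U' (i : U -> U') (E : rel U) (E' : rel U')
    (lab : U -> L) (lab' : U' -> L) (A : {set U}) :
  injective i -> (forall x y, E' (i x) (i y) = E x y) ->
  (forall x, lab' (i x) = lab x) ->
  represents V E lab A -> represents V E' lab' (i @: A).
Proof.
move=> inji eE el [->|[g Vg [phi [inj im adj lb]]]].
  by left; rewrite imset0.
right; exists g => //; exists (i \o phi); split=> [||x y|x] /=.
- exact: inj_comp.
- by rewrite imset_comp im.
- by rewrite eE.
- by rewrite el.
Qed.

Lemma represents_setU U (E : rel U) (lab : U -> L) (A B : {set U}) :
  (forall g1 g2, V g1 -> V g2 -> V (lg_union g1 g2)) ->
  [disjoint A & B] ->
  (forall x y, x \in A -> y \in B -> E x y = false /\ E y x = false) ->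
  represents V E lab A -> represents V E lab B -> represents V E lab (A :|: B).
Proof.
move=> VU dAB nE [->|[g Vg [phi [inj im adj lb]]]]; first by rewrite set0U.
case=> [->|[g' Vg' [phi' [inj' im' adj' lb']]]].
  by rewrite setU0; right; exists g => //; exists phi.
have inA x : phi x \in A by rewrite -im imset_f.
have inB x : phi' x \in B by rewrite -im' imset_f.
have neq x y : phi x <> phi' y.
  by move=> e; move: (inB y); rewrite -e (disjointFr dAB).
right; exists (lg_union g g'); first exact: VU.
exists (fun x => match x with inl x => phi x | inr x => phi' x end).
split=> [[x|x] [y|y] e||[x|x] [y|y]|[x|x]] /=.
- by rewrite (inj _ _ e).
- by case: (neq x y).
- by case: (neq y x).
- by rewrite (inj' _ _ e).
- rewrite -im -im'; apply/setP=> u; rewrite inE; apply/imsetP/orP.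
    by case=> -[x|x] _ ->; [left|right]; rewrite imset_f.
  by case=> /imsetP[x _ ->]; [exists (inl x)|exists (inr x)]; rewrite ?inE.
- exact: adj.
- by have [-> _] := nE _ _ (inA x) (inB y).
- by have [_ ->] := nE _ _ (inA y) (inB x).
- exact: adj'.
- exact: lb.
- exact: lb'.
Qed.

Lemma represents_set1 U (E : rel U) (lab : U -> L) u :
  V (lg_vertex (lab u)) -> E u u = false -> represents V E lab [set u].
Proof.
move=> Vv Eu; right; exists (lg_vertex (lab u)) => //.
exists (fun=> u); split=> // [[] []//|].
apply/setP=> w; rewrite !inE; apply/imsetP/eqP => [[_ _ ->//]|->].
by exists tt.
Qed.

Lemma represents_join U (E : rel U) (lab : U -> L) (A : {set U}) (r : rel L) :
  (forall g, V g -> V (lg_join r g)) -> represents V E lab A ->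
  represents V
    (fun x y => [|| E x y, r (lab x) (lab y) | r (lab y) (lab x)]) lab A.
Proof.
move=> Vr [->|[g Vg [phi [inj im adj lb]]]]; first by left.
right; exists (lg_join r g); first exact: Vr.
by exists phi; split=> //= x y; rewrite adj !lb.
Qed.

Lemma represents_relabel U (E : rel U) (lab : U -> L) (A : {set U}) h :
  (forall g, V g -> V (lg_relabel h g)) -> represents V E lab A ->
  represents V E (h \o lab) A.
Proof.
move=> Vr [->|[g Vg [phi [inj im adj lb]]]]; first by left.
right; exists (lg_relabel h g); first exact: Vr.
by exists phi; split=> //= x; rewrite lb.
Qed.

(** The vertex [x0] excludes the empty set, which [represents] accepts without any expression. *)
Lemma represents_setT (G : simpleGraph) (E : rel G) (lab : G -> L) (x0 : G) :
  E =2 @sadj G -> represents V E lab [set: G] ->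
  exists2 g, V g & is_value_of G g.
Proof.
move=> eE [/setP/(_ x0)|[g Vg [phi [inj im adj lb]]]]; first by rewrite !inE.
exists g => //.
have /fin_all_exists[psi psiK] (u : G) : exists x, u = phi x.
  have: u \in phi @: setT by rewrite im inE.
  by case/imsetP=> x _ ->; exists x.
exists psi; split=> [|x y]; last by rewrite adj -!psiK eE.
by exists phi => [x|x]; rewrite -?psiK //; apply: inj; rewrite -psiK.
Qed.

End Represents.

Definition cw_value l (g : labelledGraph 'I_l) : Prop :=
  exists e : cw_expr l, cw_eval e = g.

Definition hcw_value (H : loopGraph) l (g : labelledGraph ('I_l * H)) : Prop :=
  exists e : hcw_expr H l, hcw_eval e = g.

Lemma cw_value_union l (g1 g2 : labelledGraph 'I_l) :
  cw_value g1 -> cw_value g2 -> cw_value (lg_union g1 g2).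
Proof. by move=> [e1 <-] [e2 <-]; exists (CUnion e1 e2). Qed.

Lemma hcw_value_union (H : loopGraph) l (g1 g2 : labelledGraph ('I_l * H)) :
  hcw_value g1 -> hcw_value g2 -> hcw_value (lg_union g1 g2).
Proof. by move=> [e1 <-] [e2 <-]; exists (HUnion e1 e2). Qed.

(** One elementary join is used per related pair of labels. Joins leave labels unchanged, so the
    pairs can be treated one after another. *)
Lemma cw_represents_join l (U : finType) (E : rel U) (lab : U -> 'I_l)
    (A : {set U}) (r : rel 'I_l) :
  (forall a b, r a b -> a != b) -> represents (@cw_value l) E lab A ->
  represents (@cw_value l)
    (fun x y => [|| E x y, r (lab x) (lab y) | r (lab y) (lab x)]) lab A.
Proof.
move=> rirr rA.
pose ps := [seq p <- enum {: 'I_l * 'I_l} | r p.1 p.2].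
have ps_r a b : ((a, b) \in ps) = r a b by rewrite mem_filter mem_enum andbT.
have: all (fun p => p.1 != p.2) ps.
  by apply/allP=> -[a b]; rewrite ps_r; apply: rirr.
have: represents (@cw_value l) (fun x y =>
    [|| E x y, (lab x, lab y) \in [::] | (lab y, lab x) \in [::]]) lab A.
  by apply: represents_ext rA => // x y _ _; rewrite !in_nil !orbF.
suff H qs : all (fun p => p.1 != p.2) qs -> represents (@cw_value l) (fun x y =>
    [|| E x y, (lab x, lab y) \in qs | (lab y, lab x) \in qs]) lab A.
  by move=> _ /H; apply: represents_ext => // x y _ _; rewrite !ps_r.
elim: qs => [_|[a b] qs IH /= /andP[ab /IH{}IH]].
  by apply: represents_ext rA => // x y _ _; rewrite !in_nil !orbF.
have Vj : forall g, cw_value g ->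
    cw_value (lg_join (fun x y => (x == a) && (y == b)) g).
  by move=> _ [e <-]; exists (CJoin ab e).
have := represents_join Vj IH; apply: represents_ext => // x y _ _.
by rewrite !inE !xpair_eqE; do !case: (_ == _); do !case: (_ \in _); case: (E x y).
Qed.

(** Labels are moved one at a time. Idempotence makes every image a fixed point of [h], so a label
    already moved is never moved again. *)
Lemma cw_represents_relabel l (U : finType) (E : rel U) (lab : U -> 'I_l)
    (A : {set U}) (h : 'I_l -> 'I_l) :
  idempotent_fun h -> represents (@cw_value l) E lab A ->
  represents (@cw_value l) E (h \o lab) A.
Proof.
move=> hh rA.
suff H (s : seq 'I_l) : represents (@cw_value l) E
    (fun x => if lab x \in s then h (lab x) else lab x) A.
  by apply: represents_ext (H (enum 'I_l)) => // x _; rewrite mem_enum.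
elim: s => [|a s IH]; first by apply: represents_ext rA => // x _; rewrite in_nil.
have [ha|] := eqVneq a (h a).
  apply: represents_ext IH => // x _; rewrite inE.
  by have [->|] := eqVneq (lab x) a => //=; rewrite -ha if_same.
move=> neq; have Vr g : cw_value g ->
    cw_value (lg_relabel (fun y => if y == a then h a else y) g).
  by case=> e <-; exists (CRelabel neq e).
apply: represents_ext (represents_relabel Vr IH) => // x _ /=.
rewrite inE; case: (lab x \in s); rewrite ?orbT ?orbF.
  by case: eqP => // <-; apply: hh.
by case: eqP => [->|].
Qed.

(** * Bounded diversity of components bounds clique-width *)

Lemma total_nd_typing (G : loopGraph) d : total_nd_at_most G d ->
  exists t : G -> 'I_d.+1, forall x y, t x = t y -> neighbours x = neighbours y.
Proof.
case=> P [partP leP sameP].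
have inP x : pblock P x \in P.
  by apply: pblock_mem; rewrite (cover_partition partP) inE.
have ltd x : index (pblock P x) (enum P) < d.+1.
  by rewrite ltnS (leq_trans _ leP) // cardE ltnW // index_mem mem_enum.
(* [d.+1] keeps the target inhabited when [d = 0], as [inord] requires. *)
exists (fun x => inord (index (pblock P x) (enum P))) => x y /(congr1 val) /=.
rewrite !inordK // => /(congr1 (nth set0 (enum P))).
rewrite !nth_index ?mem_enum // => eqb.
have inb z : z \in pblock P z.
  by rewrite mem_pblock (cover_partition partP) inE.
by apply: (sameP _ _ _ (inP y)) => //; rewrite -eqb.
Qed.

(** [w] ranges over all of [H]: outside the component it is adjacent to neither [v] nor [v']. *)
Lemma component_typing (H : loopGraph) (c : H) d :
  total_nd_at_most (component c) d ->
  exists t : H -> 'I_d.+1, forall v v' w,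
    connect (@ladj H) c v -> connect (@ladj H) c v' -> t v = t v' ->
    ladj v w = ladj v' w.
Proof.
case/total_nd_typing=> t tP.
exists (fun v => if insub v is Some u then t u else ord0) => v v' w cv cv'.
have cD u : connect (@ladj H) c u -> u \in [set y | connect (@ladj H) c y].
  by rewrite inE.
have iE u (cu : connect (@ladj H) c u) :
    insub u = Some (exist _ u (cD _ cu) : component c) by exact: insubT.
rewrite (iE _ cv) (iE _ cv') => /tP /setP eqN.
have [cw|ncw] := boolP (connect (@ladj H) c w).
  by have := eqN (exist _ w (cD _ cw)); rewrite !inE.
have nE u : connect (@ladj H) c u -> ladj u w = false.
  move=> cu; apply: contraNF ncw => uw.
  exact: connect_trans cu (connect1 uw).
by rewrite !nE.
Qed.

(** Joins add edges only between labels whose second coordinates are adjacent in [H], and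
    relabelling keeps second coordinates. [root] serves as the name of a component. *)
Lemma hcw_eval_root (H : loopGraph) l (e : hcw_expr H l) x y :
  @gadj _ (hcw_eval e) x y ->
  root (@ladj H) (glab x).2 = root (@ladj H) (glab y).2.
Proof.
have rootE v w : ladj v w -> root (@ladj H) v = root (@ladj H) w.
  by move=> vw; apply/eqP; rewrite root_connect ?connect1 //; apply: loop_connect_sym.
elim: e x y => [i v|e1 IH1 e2 IH2|i j ij e IH|i j ij e IH] //= x y.
- by case: x y => x [] y //=; [apply: IH1|apply: IH2].
- by case/or3P=> [/IH //|/and3P[_ _ /rootE]|/and3P[_ _ /rootE]].
- by move/IH; do 2 case: ifP.
Qed.

Section ComponentExpression.
Variables (H : loopGraph) (l d : nat) (t : H -> H -> 'I_d.+1).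
Local Notation rt := (root (@ladj H)).
Hypothesis tP : forall c v v' w, rt v = c -> rt v' = c -> t c v = t c v' ->
  ladj v w = ladj v' w.

Local Notation N := #|{: 'I_l * 'I_d.+1}|.

(** The type is taken within the component of the vertex itself, so that the pieces for all
    components share one labelling and can be united directly. *)
Definition typed_label (a : 'I_l * H) : 'I_N :=
  enum_rank (a.1, t (rt a.2) a.2).

Lemma component_represents (c : H) (e : hcw_expr H l) :
  represents (@cw_value N) (@gadj _ (hcw_eval e))
    (fun x => typed_label (glab x)) [set x | rt (@glab _ (hcw_eval e) x).2 == c].
Proof.
elim: e => [i v|e1 IH1 e2 IH2|i j ij e IH|i j ij e IH] /=.
- have [vc|vc] := eqVneq (rt v) c; last first.
    by left; apply/setP=> x; rewrite !inE.
  have -> : [set _ | true] = [set tt] by apply/setP=> -[]; rewrite !inE.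
  by apply: represents_set1 => //; exists (CVertex (typed_label (i, v))).
- set A := [set x | _].
  have -> : A = (@inl _ _) @: [set x | rt (@glab _ (hcw_eval e1) x).2 == c] :|:
                (@inr _ _) @: [set x | rt (@glab _ (hcw_eval e2) x).2 == c].
    apply/setP=> -[x|x]; rewrite !inE.
      rewrite (mem_imset _ _ (@inl_inj _ _)) inE orbC.
      by case: imsetP => // -[].
    rewrite (mem_imset _ _ (@inr_inj _ _)) inE.
    by case: imsetP => // -[].
  apply: represents_setU.
  + exact: cw_value_union.
  + by rewrite disjoint_subset; apply/subsetP=> _ /imsetP[x _ ->]; rewrite inE; apply/imsetP=> -[].
  + by move=> _ _ /imsetP[x _ ->] /imsetP[y _ ->].
  + by apply: represents_imset IH1 => //; apply: inl_inj.
  + by apply: represents_imset IH2 => //; apply: inr_inj.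
(* Types are related when some vertices of component [c] having them are adjacent; by [tP] any other
   choice gives the same answer. *)
- pose r (a b : 'I_N) := [&& (enum_val a).1 == i, (enum_val b).1 == j &
    [exists v, exists w, [&& rt v == c, rt w == c, t c v == (enum_val a).2,
       t c w == (enum_val b).2 & ladj v w]]].
  have rirr a b : r a b -> a != b.
    by case/and3P=> /eqP ai /eqP bj _; apply: contra_neq ij => ab; rewrite -ai -bj ab.
  apply: represents_ext (cw_represents_join rirr IH) => // x y.
  rewrite !inE => /eqP xc /eqP yc; rewrite /= /r /typed_label !enum_rankK /= !xc !yc.
  have rE v w : rt v = c -> rt w = c ->
    [exists v', exists w', [&& rt v' == c, rt w' == c, t c v' == t c v,
       t c w' == t c w & ladj v' w']] = ladj v w.
    move=> vc wc; apply/existsP/idP => [[v' /existsP[w']]|vw]; last first.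
      by exists v; apply/existsP; exists w; rewrite vc wc !eqxx.
    case/and5P=> /eqP v'c /eqP w'c /eqP tv /eqP tw.
    by rewrite (tP _ v'c vc tv) ladj_sym (tP _ w'c wc tw) ladj_sym.
  by rewrite !rE.
- pose h (a : 'I_N) := if (enum_val a).1 == i then enum_rank (j, (enum_val a).2) else a.
  have hh : idempotent_fun h.
    move=> a; rewrite /h /=; case ai: ((enum_val a).1 == i); last by rewrite ai.
    by rewrite enum_rankK /= eq_sym (negPf ij).
  have := cw_represents_relabel hh IH.
  set B := [set x | _]; set A := [set x | _].
  have -> : A = B by apply/setP=> x; rewrite !inE; case: ifP.
  apply: represents_ext => // x _ /=.
  by rewrite /h /typed_label enum_rankK /=; case: ifP.
Qed.

(** Components are added one by one; [hcw_eval_root] excludes edges between them. Elements of [H]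
    that are not roots contribute the empty set. *)
Lemma all_components_represents (e : hcw_expr H l) :
  represents (@cw_value N) (@gadj _ (hcw_eval e))
    (fun x => typed_label (glab x)) setT.
Proof.
suff P (s : seq H) : represents (@cw_value N) (@gadj _ (hcw_eval e))
    (fun x => typed_label (glab x))
    [set x | rt (@glab _ (hcw_eval e) x).2 \in s].
  have := P (enum H); congr represents.
  by apply/setP=> x; rewrite !inE mem_enum.
elim: s => [|c s IH].
  by left; apply/setP=> x; rewrite !inE.
have [cs|cs] := boolP (c \in s).
  move: IH; congr represents; apply/setP=> x; rewrite !inE.
  by have [->|] := eqVneq.
have -> : [set x | rt (@glab _ (hcw_eval e) x).2 \in c :: s] =
   [set x | rt (@glab _ (hcw_eval e) x).2 == c] :|:
   [set x | rt (@glab _ (hcw_eval e) x).2 \in s].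
  by apply/setP=> x; rewrite !inE.
apply: represents_setU => //.
- exact: cw_value_union.
- rewrite disjoint_subset; apply/subsetP=> x; rewrite !inE => /eqP ->.
  exact: cs.
- move=> x y; rewrite !inE => /eqP xc ys.
  have neq : rt (glab x).2 <> rt (glab y).2.
    by rewrite xc => cy; rewrite cy ys in cs.
  by split; apply/negP=> /hcw_eval_root // /esym.
- exact: component_represents.
Qed.

End ComponentExpression.

Lemma hcw_eval_inhabited (H : loopGraph) l (e : hcw_expr H l) :
  inhabited (gvertex (hcw_eval e)).
Proof. by elim: e => //= e1 [x] e2 _; exists; left. Qed.

Lemma bounded_cw_of_nd (HH : loopGraph -> Prop) :
  component_bounded_total_nd HH ->
  exists f : nat -> nat,
     forall G : simpleGraph, exnat_le (cw G) (omap f (hcw HH G)).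
Proof.
(* New labels are pairs of an old label and a type. *)
case=> d dP; exists (fun l => #|{: 'I_l * 'I_d.+1}|) => G.
case E: (hcw HH G) => [l|]; last by case: (cw G).
have [_ [H /dP HP [e [phi [bphi adj]]]]] := least_Some E.
have /choice[t tP] (c : H) : exists t : H -> 'I_d.+1, forall v v' w,
    connect (@ladj H) c v -> connect (@ladj H) c v' -> t v = t v' ->
    ladj v w = ladj v' w by apply/component_typing/HP.
have tP' c v v' w : root (@ladj H) v = c -> root (@ladj H) v' = c ->
    t c v = t c v' -> ladj v w = ladj v' w.
  move=> vc v'c; apply: tP; rewrite ?(loop_connect_sym c).
    by rewrite -vc connect_root.
  by rewrite -v'c connect_root.
have [psi phiK psiK] := bphi.
have [x0] := hcw_eval_inhabited e.
have := represents_imset (E' := @sadj G)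
  (lab' := fun u => typed_label t (glab (phi u))) (can_inj psiK) _ _
  (all_components_represents tP' e).
have -> : psi @: [set: _] = [set: G].
  by apply/setP=> u; rewrite inE -[u]phiK imset_f.
case/(_ _)/(_ _)/(represents_setT (psi x0)) => //= [x y|x|].
- by rewrite -adj !psiK.
- by rewrite psiK.
move=> g [e' <-] vG.
by apply: cw_le vG.
Qed.

(** * Balanced cuts in clique-width expressions *)

(** Descend into an operand of a union while it meets more than [k] rows; when neither does, the
    whole union meets at most [2k]. [lab] keeps the labels of that moment: vertices labelled equally
    then are treated alike by all later operations, whence the invariant on [glab]. *)
Lemma cw_cut l (e : cw_expr l) (T : finType) (row : gvertex (cw_eval e) -> T) k :
  0 < k -> k < #|row @: setT| ->
  exists (S : {set gvertex (cw_eval e)}) (lab : gvertex (cw_eval e) -> 'I_l),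
    [/\ k < #|row @: S|, #|row @: S| <= k.*2 &
     forall x x', x \in S -> x' \in S -> lab x = lab x' ->
       glab x = glab x' /\ forall y, y \notin S -> gadj x y = gadj x' y].
Proof.
move=> k0; elim: e row => [i|e1 IH1 e2 IH2|i j ij e IH|i j ij e IH] /= row rk.
- have := leq_trans rk (leq_imset_card _ _).
  by rewrite cardsT card_unit ltnS leqNgt k0.
- have [k1|k1] := ltnP k #|(row \o inl) @: setT|.
    have [S [lab [kS Sk labP]]] := IH1 _ k1.
    exists (inl @: S), (fun x => match x with inl x => lab x | inr x => glab x end).
    split; rewrite -?imset_comp // => _ _ /imsetP[x xS ->] /imsetP[x' x'S ->] /=.
    case/(labP x x' xS x'S) => gl adj; split=> // -[y|y] //= yS; apply: adj.
    by apply: contraNN yS; apply: imset_f.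
  have [k2|k2] := ltnP k #|(row \o inr) @: setT|.
    have [S [lab [kS Sk labP]]] := IH2 _ k2.
    exists (inr @: S), (fun x => match x with inl x => glab x | inr x => lab x end).
    split; rewrite -?imset_comp // => _ _ /imsetP[x xS ->] /imsetP[x' x'S ->] /=.
    case/(labP x x' xS x'S) => gl adj; split=> // -[y|y] //= yS; apply: adj.
    by apply: contraNN yS; apply: imset_f.
  (* Nothing lies outside [S] yet, so only the labels matter. *)
  exists setT, (@glab _ (lg_union (cw_eval e1) (cw_eval e2))); split=> //.
    have -> : row @: setT = (row \o inl) @: setT :|: (row \o inr) @: setT.
      apply/setP=> a; rewrite inE; apply/imsetP/orP => [[[x|x] _ ->]|].
      + by left; apply/imsetP; exists x.
      + by right; apply/imsetP; exists x.
      + by case=> /imsetP[x _ ->]; [exists (inl x)|exists (inr x)]; rewrite ?inE.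
    by rewrite -addnn (leq_trans (leq_card_setU _ _)) // leq_add.
  by move=> x x' _ _ gl; split=> // y; rewrite inE.
- have [S [lab [kS Sk labP]]] := IH row rk.
  exists S, lab; split=> // x x' xS x'S /labP[] // gl adj.
  by split=> // y yS; rewrite gl adj.
- have [S [lab [kS Sk labP]]] := IH row rk.
  exists S, lab; split=> // x x' xS x'S /labP[] // gl adj.
  by split=> //; rewrite gl.
Qed.

Lemma cw_cut_graph (G : simpleGraph) l (e : cw_expr l) (T : finType)
    (row : G -> T) k :
  is_value_of G (cw_eval e) -> 0 < k -> k < #|row @: setT| ->
  exists (S : {set G}) (lab : G -> 'I_l),
    [/\ k < #|row @: S|, #|row @: S| <= k.*2 &
     forall x x' y, x \in S -> x' \in S -> y \notin S -> lab x = lab x' ->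
       sadj x y = sadj x' y].
Proof.
case=> phi [[psi phiK psiK] adj] k0 rk.
have rowE (S : {set _}) : (row \o psi) @: S = row @: (phi @^-1: S).
  apply/setP=> a; apply/imsetP/imsetP => -[x xS ->].
    by exists (psi x); rewrite // inE psiK.
  by exists (phi x) => /=; rewrite ?phiK // inE in xS *.
have [|S [lab [kS Sk labP]]] := @cw_cut l e T (row \o psi) k k0.
  by rewrite rowE preimsetT.
exists (phi @^-1: S), (lab \o phi); split; rewrite -?rowE // => x x' y.
rewrite !inE /= => xS x'S yS eql.
by have [_ /(_ _ yS)] := labP _ _ xS x'S eql; rewrite !adj.
Qed.

(** * From cuts of star products to neighbourhood diversity *)

Lemma total_nd_of_typing (G : loopGraph) (T : finType) (t : G -> T) :
  (forall x y, t x = t y -> neighbours x = neighbours y) ->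
  total_nd_at_most G #|T|.
Proof.
move=> tP; have partP := preim_partitionP t [set: G].
exists (preim_partition t [set: G]); split=> //.
  apply: leq_trans (leq_imset_card (fun a => [set y in [set: G] | a == t y]) T).
  apply: subset_leq_card; apply/subsetP=> _ /imsetP[x _ ->].
  by apply/imsetP; exists (t x).
move=> _ x y /imsetP[z _ ->]; rewrite !inE /= => /eqP zx /eqP zy.
by apply: tP; rewrite -zx.
Qed.

(** Without such an edge the image of [p] in [H] would be closed under adjacency, although [v] and
    [w] are connected in [H]. *)
Lemma component_crossing (H : loopGraph) (c : H) (p : pred (component c)) v w :
  p v -> ~~ p w ->
  exists v' w', [/\ p v', ~~ p w' & @ladj (component c) v' w'].
Proof.
move=> pv npw; apply: contrapT => nex.
pose a := [pred h | [exists u : component c, (val u == h) && p u]].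
have aE u : (val u \in a) = p u.
  rewrite inE; apply/existsP/idP => [[u' /andP[/eqP/val_inj -> //]]|pu].
  by exists u; rewrite eqxx.
have cla : closed (@ladj H) a.
  apply: intro_closed; first exact: loop_connect_sym.
  move=> h h' hh' /existsP[u /andP[/eqP uh pu]].
  have h'C : h' \in [set y | connect (@ladj H) c y].
    have := valP u; rewrite !inE => cu; apply: connect_trans cu _.
    by rewrite uh connect1.
  pose u' : component c := exist _ h' h'C; rewrite -[h']/(val u') aE.
  apply/negPn/negP => npu'; apply: nex; exists u, u'; split=> //.
  by rewrite /= /induced_adj uh.
have cH (u : component c) : connect (@ladj H) c (val u).
  by have := valP u; rewrite inE.
have /(closed_connect cla) : connect (@ladj H) (val v) (val w).
  by apply: connect_trans (cH w); rewrite loop_connect_sym.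
by rewrite !aE pv (negPf npw).
Qed.

Section StarProduct.
Variables (C : loopGraph) (m : nat).

(** Copies of one [v] in distinct adjacent rows are joined exactly when [v] has a loop, so loops of
    [C] remain visible in a simple graph. *)
Definition star_adj : rel (C * option 'I_m) := fun u v =>
  [&& u != v, ladj u.1 v.1 & [|| u.2 == v.2, u.2 == None | v.2 == None]].

Lemma star_adj_sym : symmetric star_adj.
Proof.
move=> u v; rewrite /star_adj eq_sym ladj_sym (eq_sym u.2).
by congr [&& _, _ & _ || _]; rewrite orbC.
Qed.

Lemma star_adj_irr : irreflexive star_adj.
Proof. by move=> u; rewrite /star_adj eqxx. Qed.

(* The strong product of C with the star of centre None and m leaves. *)
Definition star_product : simpleGraph :=
  SimpleGraph star_adj_sym star_adj_irr.

End StarProduct.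

(** Row by row, the type of [v] records the label of its copy if that is in [S], and otherwise the
    labels in [S] that the copy sees. *)
Lemma nd_of_pure_rows (C : loopGraph) m k (S : {set star_product C m})
    (lab : star_product C m -> 'I_k) s s' :
  (forall x x' y, x \in S -> x' \in S -> y \notin S -> lab x = lab x' ->
       sadj x y = sadj x' y) ->
  (forall v, (v, s) \in S) -> (forall v, (v, s') \notin S) ->
  total_nd_at_most C #|{ffun option 'I_m -> 'I_k + {set 'I_k}}|.
Proof.
move=> labP sS s'S.
pose t v : {ffun option 'I_m -> 'I_k + {set 'I_k}} := [ffun r =>
  if (v, r) \in S then inl (lab (v, r))
  else inr [set a | [exists u, [&& u \in S, lab u == a & star_adj (v, r) u]]]].
apply: (total_nd_of_typing (t := t)).
suff H v v' w : t v = t v' -> ladj v w -> ladj v' w.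
  move=> v v' tv; apply/setP=> w; rewrite !inE; apply/idP/idP; apply: H => //.
move=> tv vw.
(* The centre row is adjacent to all others: it is paired with [s'] if its copy of [w] is in [S],
   and with [s] otherwise. *)
have [r [r' [wr wr' rr' adjr]]] : exists r r', [/\ (w, r) \in S,
    (w, r') \notin S, r != r' & [|| r == r', r == None | r' == None]].
  have [wN|wN] := boolP ((w, None) \in S).
    exists None, s'; rewrite wN s'S eqxx orbT; split=> //.
    by apply: contraTneq wN => ->; apply: s'S.
  exists s, None; rewrite wN sS eqxx !orbT; split=> //.
  by apply: contraNneq wN => <-; apply: sS.
have := congr1 (fun f : {ffun _} => f r) tv; rewrite !ffunE.
case: ifP => vr; case: ifP => v'r //.
  (* Copies in [S] are tested against [(w, r')], which is outside. *)
  have adjE u : star_adj (u, r) (w, r') = ladj u w.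
    rewrite /star_adj xpair_eqE /=.
    by move: adjr; rewrite (negPf rr') /= => ->; rewrite andbF andbT.
  by case=> eql; have := labP _ _ _ vr v'r wr' eql; rewrite /= !adjE vw => <-.
(* The copy of [v] is outside [S] and sees [(w, r)]; so that of [v'] sees an equally labelled [u] in
   [S], hence also [(w, r)]. *)
case=> /setP/(_ (lab (w, r))); rewrite !inE => e.
have : [exists u, [&& u \in S, lab u == lab (w, r) & star_adj (v', r) u]].
  rewrite -e; apply/existsP; exists (w, r); rewrite wr eqxx /star_adj /= vw eqxx.
  by rewrite andbT; apply: contraFneq vr => ->.
case/existsP=> u /and3P[uS /eqP luw].
have /(_ (negbT v'r)) := labP u (w, r) (v', r) uS wr; rewrite /= => /(_ luw).
by rewrite star_adj_sym => -> /and3P[_ /=]; rewrite ladj_sym.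
Qed.

(* Were no row inside S, two of the more than k edges leaving S within a leaf row
   would start at equally labelled vertices, although leaf rows are not adjacent. *)
Lemma star_pure_row (H : loopGraph) (c : H) m k
    (S : {set star_product (component c) m})
    (lab : star_product (component c) m -> 'I_k) :
  (forall x x' y, x \in S -> x' \in S -> y \notin S -> lab x = lab x' ->
       sadj x y = sadj x' y) ->
  k.+1 < #|snd @: S| -> exists s, forall v, (v, s) \in S.
Proof.
move=> labP kS; apply: contrapT => nex.
(* Discarding the centre row costs one, which is why more than [k.+1] rows are assumed. *)
pose D := [set t : 'I_m | Some t \in snd @: S].
have kD : k < #|D|.
  have : snd @: S \subset None |: Some @: D.
    apply/subsetP=> -[t|] tS; rewrite !inE //.
    by apply/orP; right; apply: imset_f; rewrite inE.
  move/subset_leq_card => le; have := leq_trans kS le.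
  rewrite cardsU1 (card_imset _ Some_inj); case: (_ \notin _) => /=.
    by rewrite ltnS.
  exact: ltnW.
have cr (t : 'I_m) : exists p : component c * component c, t \in D ->
    [/\ (p.1, Some t) \in S, (p.2, Some t) \notin S & ladj p.1 p.2].
  have [tD|tD] := boolP (t \in D); last first.
    have cc : c \in [set y | connect (@ladj H) c y] by rewrite inE connect0.
    by exists (exist _ c cc, exist _ c cc).
  move: tD; rewrite inE => /imsetP[[v t'] vS /= et]; subst t'.
  have [w ws] : exists w, (w, Some t) \notin S.
    apply: contrapT => allS; apply: nex; exists (Some t) => w.
    by apply/negPn/negP => wS; apply: allS; exists w.
  have [v' [w' [vS' wS' vw]]] :=
    @component_crossing H c (fun v => (v, Some t) \in S) v w vS ws.
  by exists (v', w').
have [p pP] := choice cr.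
have : ~~ dinjectiveb (fun t => lab ((p t).1, Some t)) (mem D).
  apply/dinjectiveP => /card_in_imset eqc.
  have := max_card (mem ((fun t => lab ((p t).1, Some t)) @: D)).
  by rewrite eqc card_ord leqNgt kD.
case/dinjectivePn=> t tD [t' /andP[t't t'D] eql].
have [vS wS vw] := pP t tD; have [v'S w'S v'w'] := pP t' t'D.
have := labP _ _ _ vS v'S wS eql; move: vw; rewrite /= /star_adj /= => ->.
rewrite !xpair_eqE !eqxx /= (inj_eq Some_inj) (negPf t't) !andbF andbT.
(* The chosen edge is not a loop, as only one of its ends lies in [S]. *)
by case: eqP => // e; rewrite -e vS in wS.
Qed.

(** A cut at [k.+1] meets more than [k.+1] rows, enough for [star_pure_row], and at most [2k + 2] of
    the [2k + 3] rows, so some row avoids [S]. *)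
Lemma star_cw_nd (H : loopGraph) (c : H) l k (e : cw_expr l) : l <= k ->
  is_value_of (star_product (component c) k.*2.+2) (cw_eval e) ->
  total_nd_at_most (component c)
    #|{ffun option 'I_k.*2.+2 -> 'I_k + {set 'I_k}}|.
Proof.
move=> lk vG.
have cc : c \in [set y | connect (@ladj H) c y] by rewrite inE connect0.
have rows : snd @: [set: star_product (component c) k.*2.+2] = setT.
  apply/setP=> t; rewrite inE; apply/imsetP.
  by exists (exist _ c cc, t).
have crows : #|[set: option 'I_k.*2.+2]| = k.*2.+3.
  by rewrite cardsT card_option card_ord.
have [||S [lab [kS Sk labP]]] := @cw_cut_graph (star_product (component c) k.*2.+2) l e
  (option 'I_k.*2.+2) snd k.+1 vG => //.
  by rewrite rows crows !ltnS leqW // -addnn leq_addr.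
have [s' s'S] : exists s', s' \notin snd @: S.
  apply: contrapT => alls; move: Sk; rewrite leqNgt => /negP; apply.
  suff -> : snd @: S = setT by rewrite crows.
  apply/setP=> s; rewrite [RHS]inE; apply/negPn/negP=> sS; apply: alls.
  by exists s.
(* Widening the labels to ['I_k] makes the bound independent of [l]. *)
have labP' x x' y : x \in S -> x' \in S -> y \notin S ->
    widen_ord lk (lab x) = widen_ord lk (lab x') -> sadj x y = sadj x' y.
  move=> xS x'S yS /(congr1 val) /= eql; apply: labP => //; exact: val_inj.
have [s sS] := star_pure_row labP' kS.
apply: (nd_of_pure_rows (s' := s') labP' sS) => v.
by apply: contraNN s'S => /(imset_f snd).
Qed.

(** * A four-label expression for the star product *)

Section HcwStar.

Notation ord4 i := (@Ordinal 4 i isT).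

Lemma hcw_represents_join (H : loopGraph) (U : finType) (E : rel U)
    (st : U -> 'I_4) (c : U -> H) (A : {set U}) i j :
  i != j -> represents (@hcw_value H 4) E (fun x => (st x, c x)) A ->
  represents (@hcw_value H 4)
    (fun x y => E x y || ladj (c x) (c y) &&
       (((st x == i) && (st y == j)) || ((st y == i) && (st x == j))))
    (fun x => (st x, c x)) A.
Proof.
move=> ij rA; have Vj (g : labelledGraph ('I_4 * H)) : hcw_value g -> hcw_value
    (lg_join (fun a b => [&& a.1 == i, b.1 == j & ladj a.2 b.2]) g).
  by case=> e <-; exists (HJoin ij e).
apply: represents_ext (represents_join Vj rA) => // x y _ _ /=.
rewrite (ladj_sym (c y)); congr (_ || _).
by case: (ladj _ _); rewrite ?andbT ?andbF.
Qed.

Lemma hcw_represents_relabel (H : loopGraph) (U : finType) (E : rel U)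
    (st : U -> 'I_4) (c : U -> H) (A : {set U}) i j :
  i != j -> represents (@hcw_value H 4) E (fun x => (st x, c x)) A ->
  represents (@hcw_value H 4) E
    (fun x => (if st x == i then j else st x, c x)) A.
Proof.
move=> ij rA; have Vr (g : labelledGraph ('I_4 * H)) : hcw_value g -> hcw_value
    (lg_relabel (fun a => if a.1 == i then (j, a.2) else a) g).
  by case=> e <-; exists (HRelabel ij e).
apply: represents_ext (represents_relabel Vr rA) => // x _ /=.
by case: eqP.
Qed.

(* Label 0 is reserved for the vertex being added, which is joined to labels
   1 and 2 and then receives its permanent label. *)
Lemma hcw_represents_add (H : loopGraph) (U : finType) (E : rel U)
    (st st' : U -> 'I_4) (c : U -> H) (A : {set U}) u :
  symmetric E -> E u u = false -> u \notin A -> st' u != ord4 0 ->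
  (forall a, a \in A -> [/\ st a != ord4 0, st' a = st a &
     E u a = ladj (c u) (c a) && ((st a == ord4 1) || (st a == ord4 2))]) ->
  represents (@hcw_value H 4) E (fun x => (st x, c x)) A ->
  represents (@hcw_value H 4) E (fun x => (st' x, c x)) (u |: A).
Proof.
move=> symE Eu uA st'u stA rA.
pose st0 x := if x == u then ord4 0 else st x.
(* [E0] isolates [u], which can then enter by a disjoint union; the two joins restore its edges. *)
pose E0 x y := [&& E x y, x != u & y != u].
have neq a : a \in A -> (a == u) = false.
  by move=> aA; apply: contraNF uA => /eqP <-.
have r0 : represents (@hcw_value H 4) E0 (fun x => (st0 x, c x)) (u |: A).
  apply: represents_setU.
  - exact: hcw_value_union.
  - by rewrite disjoints1.
  - by move=> x y /set1P -> _; rewrite /E0 !eqxx !andbF.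
  - apply: represents_set1; last by rewrite /E0 Eu.
    by exists (HVertex (st0 u) (c u)).
  - apply: represents_ext rA => [x y xA yA|x xA].
      by rewrite /E0 !neq // !andbT.
    by rewrite /st0 neq.
have r1 := hcw_represents_join (isT : ord4 0 != ord4 1) r0.
have r2 := hcw_represents_join (isT : ord4 0 != ord4 2) r1.
have u0 : ord4 0 != st' u by rewrite eq_sym.
apply: represents_ext (hcw_represents_relabel u0 r2) => [x y|x] /=.
  have st0u : st0 u = ord4 0 by rewrite /st0 eqxx.
  have st0A a : a \in A -> st0 a = st a by move=> aA; rewrite /st0 neq.
  rewrite /E0; case/setU1P=> [->|xA]; case/setU1P=> [->|yA].
  - by rewrite st0u Eu /= !andbF.
  - have [/negPf y0 _ ->] := stA _ yA; rewrite st0u st0A // y0 eqxx /= !andbF /= !orbF.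
    by rewrite andb_orr.
  - have [/negPf x0 _ Eux] := stA _ xA.
    rewrite symE Eux ladj_sym st0u st0A // x0 eqxx /= !andbF /=.
    by rewrite andb_orr.
  - have [/negPf x0 _ _] := stA _ xA; have [/negPf y0 _ _] := stA _ yA.
    by rewrite !st0A // x0 y0 !neq // /= !andbF !andbT !orbF.
rewrite /st0; case: (eqVneq x u) => [->|xu]; first by rewrite eqxx.
case/setU1P=> [xu'|xA]; first by rewrite xu' eqxx in xu.
by have [/negPf -> ->] := stA _ xA.
Qed.

Variables (H : loopGraph) (c : H) (m : nat).
Local Notation C := (component c).
Local Notation G := (star_product C m).
Local Notation rep st A := (represents (@hcw_value H 4) (@sadj G)
  (fun u : G => (st u, val u.1 : H)) A).

(* Label 2 marks the row None, label 1 the row r under construction, and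
   label 3 the other finished rows. *)
Definition row_label (r : option 'I_m) (u : G) : 'I_4 :=
  if u.2 == None then ord4 2 else if u.2 == r then ord4 1 else ord4 3.

(** A new vertex needs edges only to its own row and to the centre row, labels 1 and 2. The centre
    must come first, since its vertices would otherwise also need edges to finished leaf rows, whose
    label is 3. *)
Lemma hcw_represents_row (r : option 'I_m) (rs : seq (option 'I_m)) :
  r \notin rs -> (r = None -> rs = [::]) ->
  rep (row_label None) [set u : G | u.2 \in rs] ->
  rep (row_label None) [set u : G | u.2 \in r :: rs].
Proof.
move=> rrs rN rA.
pose A (s : seq C) := [set u : G | (u.2 \in rs) || (u.2 == r) && (u.1 \in s)].
have {}rA : rep (row_label r) (A [::]).
  have -> : A [::] = [set u : G | u.2 \in rs].
    by apply/setP=> u; rewrite !inE andbF orbF.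
  apply: represents_ext rA => // -[v t]; rewrite inE /row_label /= => tr.
  by case: eqP => // _; case: eqP => // e; rewrite -e tr in rrs.
have rA' s : uniq s -> rep (row_label r) (A s).
  elim: s => [//|v s IH] /= /andP[vs /IH{}IH].
  have -> : A (v :: s) = (v, r) |: A s.
    apply/setP=> -[w t]; rewrite !inE /= xpair_eqE.
    by case: (w == v); case: (t == r); case: (t \in rs); case: (w \in s).
  apply: hcw_represents_add IH.
  - exact: sadj_sym.
  - exact: sadj_irr.
  - by rewrite inE /= (negPf rrs) eqxx.
  - by rewrite /row_label; case: ifP => // _; case: ifP.
  - move=> [w t]; rewrite inE /= => At; split=> //.
      by rewrite /row_label; case: ifP => // _; case: ifP.
    have -> : star_adj (v, r) (w, t) =
        ladj v w && [|| r == t, r == None | t == None].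
      rewrite /star_adj /=; suff -> : (v, r) != (w, t) by [].
      apply: contraTneq At => -[<- <-].
      by rewrite (negPf rrs) eqxx.
    congr (_ && _); rewrite /row_label /=.
    have [tN|tN] := eqVneq t None; first by rewrite !orbT.
    rewrite orbF (eq_sym r t).
    have [tr|tr] := eqVneq t r; first by [].
    case: (eqVneq r None) => // /rN rs0.
    by move: At; rewrite rs0 (negPf tr).
have := hcw_represents_relabel (isT : ord4 1 != ord4 3) (rA' _ (enum_uniq C)).
have -> : A (enum C) = [set u : G | u.2 \in r :: rs].
  by apply/setP=> u; rewrite !inE mem_enum andbT orbC.
apply: represents_ext => // -[v t] _; rewrite /row_label /=.
by case: (t == None) => //; case: (t == r).
Qed.

Lemma star_hcw : exists e : hcw_expr H 4, is_value_of G (hcw_eval e).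
Proof.
have rN : rep (row_label None) [set u : G | u.2 \in [:: None]].
  apply: hcw_represents_row => //.
  by left; apply/setP=> u; rewrite !inE.
(* The head of the list is the row built last, so [rcons] puts the centre first in the
   construction. *)
have rs (s : seq 'I_m) : uniq s -> rep (row_label None)
    [set u : G | u.2 \in rcons (map some s) None].
  elim: s => [//|t s IH] /= /andP[ts /IH]; apply: hcw_represents_row => //.
  by rewrite mem_rcons inE /= (mem_map (@Some_inj _)).
have cc : c \in [set y | connect (@ladj H) c y] by rewrite inE connect0.
have := rs _ (enum_uniq 'I_m).
have -> : [set u : G | u.2 \in rcons (map some (enum 'I_m)) None] = setT.
  apply/setP=> -[v [t|]]; rewrite !inE mem_rcons inE //=.
  by rewrite (mem_map (@Some_inj _)) mem_enum.
case/(represents_setT (G := G) (exist _ c cc : C, None)) => // g [e <-] vG.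
by exists e.
Qed.

End HcwStar.

(** * Bounded clique-width bounds the diversity of components *)

Lemma nd_bounded_of_cw (HH : loopGraph -> Prop) (f : nat -> nat) :
  (forall G : simpleGraph, exnat_le (cw G) (omap f (hcw HH G))) ->
  component_bounded_total_nd HH.
Proof.
(* The [HH]-clique-width of the star product is only known to be at most 4, and [f] need not be
   monotone. *)
move=> fP; pose k := \max_(i < 5) f i.
exists #|{ffun option 'I_k.*2.+2 -> 'I_k + {set 'I_k}}| => H HHH c.
pose G := star_product (component c) k.*2.+2.
have [l hl l4] : exists2 l, hcw HH G = Some l & l <= 4.
  by apply: least_le; split=> //; exists H => //; apply: star_hcw.
have := fP G; rewrite hl /=; case E: (cw G) => [k'|//] /= k'f.
have [e vG] := least_Some E.
apply: star_cw_nd vG; apply: leq_trans k'f _.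
exact: (leq_bigmax (Ordinal (l4 : l < 5))).
Qed.

Theorem theorem3p1 (HH : loopGraph -> Prop) :
  (exists f : nat -> nat,
     forall G : simpleGraph, exnat_le (cw G) (omap f (hcw HH G)))
  <-> component_bounded_total_nd HH.
Proof.
by split=> [[f /nd_bounded_of_cw]|/bounded_cw_of_nd].
Qed.
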